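(* For each integer $n\geq 13$ there is a suspension $(S,r)$ with $|S|=n$ such that \[e_r(S)\geq \left\lceil\frac{n^2}{4}+\frac{5n}{2}\right\rceil+1.\]
   Context: Let $d(x,y)$ denote Euclidean distance in $\mathbb{R}^3$, and $d(x,A)$ the distance from the point $x$ to the set $A$. For a finite set $S\subset\mathbb{R}^3$ and a function $r\colon S\to(0,\infty)$, let $\vec{E}_r(S)=\{(x,y) : x,y\in S,\ d(x,y)=r(x)\}$ (a set of ordered pairs) and $e_r(S)=|\vec{E}_r(S)|$. The axis of symmetry of a circle $\mathcal{C}$ in $\mathbb{R}^3$ is the line through the centre of $\mathcal{C}$ perpendicular to the plane of $\mathcal{C}$. A finite set $S\subset\mathbb{R}^3$ together with a function $r\colon S\to(0,\infty)$ is called a suspension if there is a circle $\mathcal{C}$ (of positive radius) in $\mathbb{R}^3$ with axis of symmetry $\mathcal{L}$ such that $S\subset\mathcal{C}\cup\mathcal{L}$ and $r(x)=d(x,\mathcal{C})$ for all $x\in S\cap\mathcal{L}$. *)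

(* Defs.v *)
From HB Require Import structures.
From mathcomp Require Import all_boot all_order all_algebra finmap.
From mathcomp Require Import all_classical all_reals.

Set Implicit Arguments.
Unset Strict Implicit.
Unset Printing Implicit Defensive.

Import Order.TTheory GRing.Theory Num.Theory.

Local Open Scope classical_set_scope.
Local Open Scope ring_scope.

Section Suspension.
Variable R : realType.
Local Notation point := 'rV[R]_3.

Definition dot (u v : point) : R := \sum_i u 0 i * v 0 i.

(* The library norm on row vectors is the sup norm, hence this definition. *)
Definition dist (x y : point) : R := Num.sqrt (dot (x - y) (x - y)).

Definition dist_set (x : point) (A : set point) : R := inf [set dist x y | y in A].

(* The plane of the circle is the plane through c normal to u; u is not
   required to be a unit vector, only nonzero. *)
Definition circle (c u : point) (rho : R) : set point :=
  [set x | dot (x - c) u = 0 /\ dist x c = rho].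

Definition axis (c u : point) : set point := [set c + t *: u | t in [set: R]].

Definition vecE (S : {fset point}) (r : S -> R) : {set S * S} :=
  [set p : S * S | dist (val p.1) (val p.2) == r p.1].

Definition e (S : {fset point}) (r : S -> R) : nat := #|vecE r|.

Definition suspension (S : {fset point}) (r : S -> R) : Prop :=
  (forall x : S, 0 < r x) /\
  exists (c u : point) (rho : R), [/\ u != 0, 0 < rho,
    [set` S] `<=` circle c u rho `|` axis c u &
    forall x : S, axis c u (val x) -> r x = dist_set (val x) (circle c u rho)].

End Suspension.

(* Main.v *)
(** Take p = floor ((n + 3) / 2) points on the unit circle in the plane z = 0
    and q = n - p points on the z-axis. Every axis point sees the whole circle,
    which gives p q pairs. An axis point t sees the axis points
    t +- sqrt (1 + t^2); starting from 0 one gets 1 and -1, then 1 - sqrt 2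
    and sqrt 2 - 1, then an increasing sequence of new heights, and each point
    except 0 is seen exactly once, which gives q - 1 pairs. Put
    c = sqrt 2 - 1. A circle point in a full inscribed square sees, at
    distance sqrt 2, its two neighbours in the square and the heights 1, -1.
    The points of the square of (1, 0) see instead, at distance
    sqrt (1 + c^2) = sqrt (2 - 2c), the heights c, -c and the two circle points
    at angles +- arccos c, so any p mod 4 of them may be used once the two
    squares at these angles are full. This gives 4 p pairs for every p >= 8. *)

Require Import Defs.
From mathcomp Require Import all_boot all_order all_algebra finmap.
From mathcomp Require Import all_classical all_reals.
From mathcomp Require Import lra zify.
Import Order.TTheory GRing.Theory Num.Theory.
Local Open Scope ring_scope.

Set Implicit Arguments.
Unset Strict Implicit.
Unset Printing Implicit Defensive.

Section Construction.
Variable R : realType.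
Local Notation point := 'rV[R]_3.

(** Since the radius is the restriction of a function [f] on all of space, the pairs can be listed
    as plain points, free of membership proofs. *)
Lemma leq_size_e (S : {fset point}) (f : point -> R) (L : seq (point * point)) :
  uniq L ->
  {in L, forall v, [/\ v.1 \in S, v.2 \in S & dist v.1 v.2 = f v.1]} ->
  (size L <= e (fun x : S => f (val x)))%N.
Proof.
move=> uL hL; rewrite /e cardE.
rewrite -(size_map (fun v : S * S => (val v.1, val v.2))).
apply: uniq_leq_size => // -[x y] /hL /= [xS yS xy].
apply/mapP; exists ([` xS]%fset, [` yS]%fset) => //.
by rewrite mem_enum inE /=; apply/eqP.
Qed.

(** * Coordinates, the unit circle and its axis *)

Definition pt (a b t : R) : point := \row_i [:: a; b; t]`_i.

Lemma pt_inj a b t a' b' t' :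
  pt a b t = pt a' b' t' -> [/\ a = a', b = b' & t = t'].
Proof.
move=> /rowP E; move: (E 0) (E 1) (E (@inord 2 2)).
by rewrite !mxE !inordK //=.
Qed.

Lemma dot_pt a b t a' b' t' :
  dot (pt a b t) (pt a' b' t') = a * a' + b * b' + t * t'.
Proof. by rewrite /dot !big_ord_recl big_ord0 !mxE /= addr0 addrA. Qed.

Lemma ptB a b t a' b' t' :
  pt a b t - pt a' b' t' = pt (a - a') (b - b') (t - t').
Proof. by apply/rowP => -[[|[|[|i]]] hi] //; rewrite !mxE. Qed.

Lemma dist_pt a b t a' b' t' :
  dist (pt a b t) (pt a' b' t') =
  Num.sqrt ((a - a') ^+ 2 + (b - b') ^+ 2 + (t - t') ^+ 2).
Proof. by rewrite /dist ptB dot_pt !expr2. Qed.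

Lemma ptP (v : point) : exists a b t, v = pt a b t.
Proof.
exists (v 0 0), (v 0 1), (v 0 (@inord 2 2)).
apply/rowP => -[[|[|[|i]]] hi] //; rewrite !mxE /=; congr (v 0 _); apply: val_inj => //=.
by rewrite inordK.
Qed.

Definition ax (t : R) : point := pt 0 0 t.

Definition unit_circle : set point := circle 0 (ax 1) 1.

Lemma pt0 : 0 = pt 0 0 0.
Proof. by apply/rowP => -[[|[|[|i]]] hi] //; rewrite !mxE. Qed.

Lemma unit_circleP a b t : unit_circle (pt a b t) <-> t = 0 /\ a ^+ 2 + b ^+ 2 = 1.
Proof.
rewrite /unit_circle /circle /= [in dist _ _]pt0 subr0 dist_pt dot_pt.
rewrite !mulr0 !add0r mulr1 !subr0; split=> -[-> h]; split=> //.
  move: h; rewrite expr0n addr0 => h.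
  by rewrite -[RHS](expr1n _ 2) -h sqr_sqrtr // addr_ge0 ?sqr_ge0.
by rewrite h expr0n addr0 sqrtr1.
Qed.

Lemma axis_ax v : axis 0 (ax 1) v <-> exists t, v = ax t.
Proof.
have E t : 0 + t *: ax 1 = ax t.
  by apply/rowP => -[[|[|[|i]]] hi] //; rewrite !mxE /= ?mulr0 ?mulr1 ?add0r.
split=> [[t _ <-]|[t ->]]; first by exists t.
by exists t.
Qed.

Lemma dist_set_ax t : dist_set (ax t) unit_circle = Num.sqrt (1 + t ^+ 2).
Proof.
(* A point of the axis is equidistant from all points of the circle, so the infimum is over a
   singleton. *)
rewrite /dist_set (_ : [set _ | _ in _]%classic = [set Num.sqrt (1 + t ^+ 2)]%classic) ?inf1 //.
apply/seteqP; split => [_ [y + <-]|_ ->] /=.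
  have [a [b [u ->]]] := ptP y => /unit_circleP [-> h].
  by rewrite dist_pt !sub0r !sqrrN h subr0.
exists (pt 1 0 0); first by apply/unit_circleP; rewrite expr0n expr1n addr0.
by rewrite dist_pt !sub0r !sqrrN subr0 expr0n expr1n addr0.
Qed.

(** * The constant [c] and the points of the circle *)

Definition c : R := Num.sqrt 2 - 1.
(* The sine of arccos x. *)
Definition cc (x : R) : R := Num.sqrt (1 - x ^+ 2).

Lemma c_itv : 0 < c < 1.
Proof.
rewrite /c; have := sqr_sqrtr (ler0n R 2); have := sqrtr_ge0 (2 : R).
by move: (Num.sqrt _) => y h1 h2; apply/andP; split; nra.
Qed.

(** Read as [1 + c ^+ 2 = 2 - 2 * c], this equates two distances from (1, 0); read as
    [(1 + c) ^+ 2 = 2], it lets -1 see [c] and 1 see [- c]. *)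
Lemma c_sqr : c ^+ 2 = 1 - 2 * c.
Proof. by rewrite /c; have := sqr_sqrtr (ler0n R 2); lra. Qed.

Lemma cc_ge0 x : 0 <= cc x. Proof. exact: sqrtr_ge0. Qed.

Lemma cc_sqr x : 0 < x <= 1 -> cc x ^+ 2 = 1 - x ^+ 2.
Proof. by move=> /andP[h1 h2]; rewrite sqr_sqrtr //; nra. Qed.

Lemma cc1 : cc 1 = 0. Proof. by rewrite /cc expr1n subrr sqrtr0. Qed.

Lemma ccK x : 0 < x <= 1 -> cc (cc x) = x.
Proof.
move=> h; rewrite {1}/cc cc_sqr // opprB addrC subrK sqrtr_sqr ger0_norm //.
by case/andP: h => /ltW.
Qed.

Lemma cc_itv x : 0 < x < 1 -> 0 < cc x < 1.
Proof.
move=> /andP[h1 h2]; have := cc_ge0 x; have := @cc_sqr x.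
by rewrite h1 (ltW h2) => /(_ isT); move: (cc x) => y h3 h4; apply/andP; split; nra.
Qed.

(* The point at x + i * sqrt (1 - x^2), turned by k quarter turns. *)
Definition cpt (i : R * nat) : point :=
  let: (x, k) := i in
  match k with
  | 0 => pt x (cc x) 0
  | 1 => pt (- cc x) x 0
  | 2 => pt (- x) (- cc x) 0
  | _ => pt (cc x) (- x) 0
  end.

Definition is_idx (i : R * nat) := (0 < i.1 <= 1) && (i.2 < 4)%N.

Lemma cpt_circle i : is_idx i -> unit_circle (cpt i).
Proof.
case: i => x k /andP[/= /cc_sqr h _].
by case: k => [|[|[|k]]] /=; apply/unit_circleP; split=> //; rewrite ?sqrrN; lra.
Qed.

(** The arc x > 0, y >= 0 is a fundamental domain for the quarter turns, so the signs of the
    coordinates determine [k]. *)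
Lemma cpt_inj : {in is_idx &, injective cpt}.
Proof.
move=> [x k] [x' k'] /andP[/= /andP[x0 _] k4] /andP[/= /andP[x'0 _] k'4].
have := cc_ge0 x; have := cc_ge0 x' => y0 y'0.
case: k k4 => [|[|[|[|k]]]] // _; case: k' k'4 => [|[|[|[|k']]]] // _ /=;
  move=> /pt_inj[e1 e2 _]; try (exfalso; lra).
- by rewrite e1.
- by rewrite e2.
- by rewrite (oppr_inj e1).
- by rewrite (oppr_inj e2).
Qed.

Arguments cpt : simpl never.

(** * Radii and the four neighbours of a circle point *)

(** On the circle, a vanishing product of coordinates singles out the square of (1, 0). *)
Definition radius (v : point) : R :=
  if (v 0 0 == 0) && (v 0 1 == 0) then Num.sqrt (1 + v 0 (@inord 2 2) ^+ 2)
  else if v 0 0 * v 0 1 == 0 then Num.sqrt (2 - 2 * c) else Num.sqrt 2.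

Lemma radius_pt a b t : radius (pt a b t) =
  if (a == 0) && (b == 0) then Num.sqrt (1 + t ^+ 2)
  else if a * b == 0 then Num.sqrt (2 - 2 * c) else Num.sqrt 2.
Proof. by rewrite /radius !mxE inordK. Qed.

Lemma radius_ax t : radius (ax t) = Num.sqrt (1 + t ^+ 2).
Proof. by rewrite radius_pt eqxx. Qed.

Lemma radius_gt0 v : 0 < radius v.
Proof.
rewrite /radius; have := c_itv => /andP[_ h].
by case: ifP => _; [|case: ifP => _]; rewrite sqrtr_gt0; have := sqr_ge0 (v 0 (@inord 2 2)); lra.
Qed.

(** Adding 3 modulo 4 turns back once: it takes (cc c, c) to (c, - cc c), the mirror image of (c, cc
    c). *)
Definition nbr (i : R * nat) : seq point :=
  if i.1 == 1 then
    [:: cpt (c, i.2); cpt (cc c, ((i.2 + 3) %% 4)%N); ax c; ax (- c)]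
  else
    [:: cpt (i.1, ((i.2 + 1) %% 4)%N); cpt (i.1, ((i.2 + 3) %% 4)%N); ax 1; ax (- 1)].

Lemma size_nbr i : size (nbr i) = 4%N.
Proof. by rewrite /nbr; case: ifP. Qed.

Lemma circle_not_ax i t : is_idx i -> cpt i != ax t.
Proof.
move=> /cpt_circle h; apply/eqP => E; move: h; rewrite E => /unit_circleP [_].
by rewrite expr0n addr0 => /eqP; rewrite eq_sym oner_eq0.
Qed.

Lemma ax_inj : injective ax.
Proof. by move=> a b /pt_inj[]. Qed.

Lemma uniq_nbr i : is_idx i -> uniq (nbr i).
Proof.
case: i => x k /andP[/= hx hk].
have /andP[c0 c1] := c_itv; have /cc_itv/andP[s0 s1] := c_itv.
have hc : 0 < c <= 1 by rewrite c0 ltW.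
have hs : 0 < cc c <= 1 by rewrite s0 ltW.
have hm m : (m %% 4 < 4)%N by rewrite ltn_mod.
have idx y m : 0 < y <= 1 -> (m < 4)%N -> is_idx (y, m) by rewrite /is_idx => -> ->.
rewrite /nbr /=; case: ifP => _ /=;
  rewrite !inE !negb_or !circle_not_ax ?idx //= !andbT (inj_eq ax_inj);
  apply/andP; split.
- apply/eqP => /cpt_inj.
  move=> /(_ (idx _ _ hc hk) (idx _ _ hs (hm _))) [_] E.
  by move: hk E; case: k => [|[|[|[|k]]]].
- by apply/eqP; lra.
- apply/eqP => /cpt_inj.
  move=> /(_ (idx _ _ hx (hm _)) (idx _ _ hx (hm _))) [] E.
  by move: hk E; case: k => [|[|[|[|k]]]].
- by apply/eqP; lra.
Qed.

Lemma nbr_dist i v : is_idx i -> v \in nbr i -> dist (cpt i) v = radius (cpt i).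
Proof.
have /andP[c0 c1] := c_itv; have c2 := c_sqr.
have hc : 0 < c <= 1 by rewrite c0 ltW.
have s2 := cc_sqr hc.
case: i => x k /andP[/= hx hk]; rewrite /nbr /=.
have [->|x1] := eqVneq x 1.
  case: k hk => [|[|[|[|k]]]] // _; rewrite !inE /cpt /= ccK // => /or4P[] /eqP ->;
  rewrite cc1 ?oppr0 dist_pt radius_pt eqxx ?oppr_eq0 ?oner_eq0 ?andbF ?mulr0 ?mul0r ?eqxx /=;
  congr Num.sqrt; lra.
have y2 := cc_sqr hx; have /andP[x0 x1'] := hx.
have /andP[y0 _] : 0 < cc x < 1 by rewrite cc_itv // x0 lt_neqAle x1.
have xn : x != 0 by rewrite gt_eqF.
have yn : cc x != 0 by rewrite gt_eqF.
case: k hk => [|[|[|[|k]]]] // _; rewrite !inE /cpt /= => /or4P[] /eqP ->;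
rewrite dist_pt radius_pt ?mulf_eq0 ?oppr_eq0 (negbTE xn) (negbTE yn) /=;
congr Num.sqrt; lra.
Qed.

(** * From lists of heights, links and circle indices to a suspension *)

Lemma suspension_of_lists (H : seq R) (T : seq (R * R)) (I : seq (R * nat)) :
  uniq H -> uniq (unzip2 T) ->
  {in T, forall t, [/\ t.1 \in H, t.2 \in H & (t.1 - t.2) ^+ 2 = 1 + t.1 ^+ 2]} ->
  uniq I -> {in I, forall i, is_idx i} ->
  {in I, forall i, {subset nbr i <= map cpt I ++ map ax H}} ->
  exists (S : {fset point}) (r : S -> R),
    [/\ suspension r, #|` S| = (size I + size H)%N &
      (size I * size H + 4 * size I + size T <= e r)%N].
Proof.
move=> uH uT hT uI hI hN.
have uC : uniq (map cpt I).
  by rewrite map_inj_in_uniq // => i j /hI hi /hI hj; exact: cpt_inj.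
have uA : uniq (map ax H) by rewrite map_inj_uniq //; exact: ax_inj.
have neq_ax i t : i \in I -> cpt i <> ax t.
  by move=> /hI hi; apply/eqP/circle_not_ax.
have CA v : v \in map cpt I -> v \in map ax H -> False.
  by move=> /mapP[i hi ->] /mapP[t _ /(neq_ax _ _ hi)].
pose S := [fset v in map cpt I ++ map ax H]%fset.
exists S, (fun v => radius (val v)); split.
- split=> [v|]; first exact: radius_gt0.
  exists 0, (ax 1), 1; split => //.
  + apply/eqP; rewrite pt0 => /pt_inj[_ _ /eqP]; by rewrite oner_eq0.
  + move=> v /=; rewrite in_fset /= mem_cat => /orP[/mapP[i /hI hi ->]|/mapP[t _ ->]].
      by left; apply: cpt_circle.
    by right; apply/axis_ax; exists t.
  + move=> v /axis_ax[t ->]; rewrite radius_ax; exact: esym (dist_set_ax t).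
- rewrite card_fseq undup_id ?size_cat ?size_map // cat_uniq uC uA andbT.
  by apply/hasPn => v vA; apply/negP => /CA; apply.
(* Pairs from axis to circle, from circle to anything, and from axis to axis: the kinds of their
   ends make the three families disjoint. *)
pose E1 := [seq (ax t, cpt i) | i <- I, t <- H].
pose E2 := [seq (cpt i, v) | i <- I, v <- nbr i].
pose E3 := [seq (ax t.1, ax t.2) | t <- T].
have -> : (size I * size H + 4 * size I + size T)%N = size (E1 ++ E2 ++ E3).
  rewrite !size_cat size_allpairs size_map size_allpairs_dep addnA; congr (_ + _ + _)%N.
  elim: (I) => //= i s <-; rewrite size_nbr; lia.
apply: leq_size_e.
  rewrite !cat_uniq; apply/and5P; split.
  - apply: allpairs_uniq => // -[i t] [i' t'] /allpairsP[[? ?] [/= hi _ [-> _]]].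
    move=> /allpairsP[[? ?] [/= hi' _ [-> _]]] [/pt_inj[_ _ ->] E].
    by rewrite (cpt_inj (hI _ hi) (hI _ hi') E).
  - apply/hasPn => p /[!mem_cat] /orP h; apply/negP => /allpairsP[[i t] [/= hi ht Ep]].
    case: h => [/allpairsPdep[j [v [/= hj _ Ej]]]|/mapP[s _ Es]].
      by move: Ej; rewrite Ep => -[/esym/(neq_ax j t hj)].
    by move: Es; rewrite Ep => -[_ /(neq_ax i s.2 hi)].
  - apply: allpairs_uniq_dep => // [i /hI|[i v] [i' v']]; first exact: uniq_nbr.
    move=> /allpairsPdep[j [w [hj _ /(congr1 tag) /= ->]]].
    move=> /allpairsPdep[j' [w' [hj' _ /(congr1 tag) /= ->]]] /= [E ->].
    by rewrite (cpt_inj (hI _ hj) (hI _ hj') E).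
  - apply/hasPn => p /mapP[t _ ->]; apply/negP => /allpairsPdep[i [v [/= hi _ [/esym/eqP]]]].
    by move=> h _; move: h; apply/negP/circle_not_ax/hI.
  - apply: (@map_uniq _ _ snd); rewrite -map_comp.
    rewrite (_ : map _ T = map ax (unzip2 T)); last by rewrite -map_comp.
    by rewrite map_inj_uniq //; exact: ax_inj.
move=> p; rewrite !mem_cat !in_fset /= !mem_cat => /or3P[].
- move=> /allpairsP[[i t] [/= hi ht ->]] /=; split.
  + by rewrite map_f ?orbT.
  + by rewrite map_f.
  + rewrite radius_ax; case: i hi (cpt_circle (hI _ hi)) => x k hi.
    have [a [b [u ->]]] := ptP (cpt (x, k)) => /unit_circleP [-> h].
    by rewrite dist_pt !sub0r !sqrrN h subr0.
- move=> /allpairsPdep[i [v [/= hi hv ->]]] /=; split.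
  + by rewrite map_f.
  + by rewrite -mem_cat; exact: hN hv.
  + exact: nbr_dist (hI _ hi) hv.
- move=> /mapP[t /hT[h1 h2 h3] ->] /=; split.
  + by rewrite map_f ?orbT.
  + by rewrite map_f ?orbT.
  + by rewrite dist_pt radius_ax subrr expr0n !add0r h3.
Qed.

(** * Heights on the axis *)

(** This is cot (pi / 2^(k+1)), by cot x + 1 / sin x = cot (x / 2). *)
Fixpoint height (k : nat) : R :=
  if k is k'.+1 then height k' + Num.sqrt (1 + height k' ^+ 2) else 0.

Lemma height_step k : (height k - height k.+1) ^+ 2 = 1 + height k ^+ 2.
Proof.
by rewrite /= opprD addrA subrr sub0r sqrrN sqr_sqrtr // addr_ge0 // sqr_ge0.
Qed.

Lemma height1 : height 1 = 1.
Proof. by rewrite /= expr0n add0r addr0 sqrtr1. Qed.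

Lemma height_lt : {homo height : j k / (j < k)%N >-> j < k}.
Proof.
apply: homo_ltn => [|k /=]; first exact: lt_trans.
by rewrite ltrDl sqrtr_gt0; have := sqr_ge0 (height k); lra.
Qed.

Arguments height : simpl never.

Lemma height_inj : injective height.
Proof.
by move=> j k E; case: (ltngtP j k) => // /height_lt; rewrite E ltxx.
Qed.

Definition heights (m : nat) : seq R :=
  [:: - 1; c; - c] ++ [seq height k | k <- iota 0 m.+2].

Lemma uniq_heights m : uniq (heights m).
Proof.
have /andP[c0 c1] := c_itv.
rewrite /heights cat_uniq (map_inj_uniq height_inj) iota_uniq andbT.
apply/andP; split.
  rewrite /= !inE !negb_or !andbT.
  by rewrite -andbA; apply/and3P; split; apply/eqP; lra.
apply/hasPn => t /mapP[k _ ->]; rewrite !inE.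
have h0 : 0 <= height k by case: k => // k; exact/ltW/(height_lt (ltn0Sn k)).
(* The gap between 0 and 1 keeps [c] out of the sequence. *)
have h1 : height k = 0 \/ 1 <= height k.
  case: k h0 => [|[|k]] h0; [by left|by right; rewrite height1|right].
  by rewrite -height1; exact/ltW/height_lt.
by rewrite !negb_or; apply/and3P; split; apply/eqP; lra.
Qed.

Lemma height_in m k : (k < m.+2)%N -> height k \in heights m.
Proof. by move=> hk; rewrite mem_cat map_f ?orbT // mem_iota. Qed.

(** A tree rooted at 0, with edges directed away from the root: the targets are the entries of
    [heights m] other than 0, once each. *)
Definition links (m : nat) : seq (R * R) :=
  [:: (0, - 1); (- 1, c); (1, - c)] ++ [seq (height k, height k.+1) | k <- iota 0 m.+1].

Lemma unzip2_links m :
  unzip2 (links m) = [:: - 1; c; - c] ++ [seq height k | k <- iota 1 m.+1].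
Proof. by rewrite /unzip2 /links map_cat -map_comp (iotaDl 1 0) -map_comp. Qed.

Lemma uniq_links m : uniq (unzip2 (links m)).
Proof.
rewrite unzip2_links; apply: subseq_uniq (uniq_heights m).
exact: cat_subseq (subseq_refl _) (subseq_cons _ _).
Qed.

Lemma linksP m : {in links m, forall t,
  [/\ t.1 \in heights m, t.2 \in heights m & (t.1 - t.2) ^+ 2 = 1 + t.1 ^+ 2]}.
Proof.
have hh := @height_in m; have h1 : 1 \in heights m by rewrite -height1 hh.
have h0 : 0 \in heights m by rewrite -[0]/(height 0) hh.
have hc x : x \in [:: - 1; c; - c] -> x \in heights m by rewrite mem_cat => ->.
have c2 := c_sqr.
move=> t; rewrite mem_cat => /orP[|/mapP[k /[!mem_iota] /= hk ->]]; last first.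
  by split; [apply: hh; exact: leqW|exact: hh|exact: height_step].
by rewrite !inE => /or3P[] /eqP -> /=; split=> //;
  try (by apply: hc; rewrite !inE eqxx ?orbT); lra.
Qed.

(** * Choice of the circle points *)

(* First coordinates of generators of the full squares. The square of
   (c, - cc c) is generated by (cc c, c); the numbers 1 / (k + 3) are arbitrary
   values in (0, 1) other than c and cc c. *)
Definition gens (b : nat) : seq R := [:: c; cc c] ++ [seq k.+3%:R^-1 | k <- iota 0 b].

Lemma gens_itv b x : x \in gens b -> 0 < x < 1.
Proof.
have hc := c_itv; have hs := cc_itv hc.
rewrite mem_cat !inE => /orP[/orP[]/eqP -> //|/mapP[k _ ->]].
by rewrite invr_gt0 ltr0n /= invf_lt1 ?ltr0n // ltr1n.
Qed.

(** The reciprocals start at 1/3 so as to stay below [c], and [c < cc c] because 2 c^2 < 1. *)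
Lemma uniq_gens b : uniq (gens b).
Proof.
have /andP[c0 c1] := c_itv; have c2 := c_sqr.
have s2 := @cc_sqr c; have s0 := cc_ge0 c.
rewrite c0 (ltW c1) in s2; move/(_ isT): s2 => s2.
have c13 : 3^-1 < c by nra.
have cs : c < cc c.
  rewrite ltNge; apply/negP => h; have : cc c * cc c <= c * c by rewrite ler_pM.
  by rewrite -!expr2; nra.
rewrite cat_uniq /= inE lt_eqF //=; apply/andP; split.
  apply/hasPn => x /mapP[k _ ->]; have : k.+3%:R^-1 <= 3^-1 :> R.
    by rewrite lef_pV2 ?posrE ?ltr0n // ler_nat.
  move=> h; rewrite !inE (lt_eqF (le_lt_trans h c13)) lt_eqF //.
  exact: lt_trans (le_lt_trans h c13) cs.
rewrite map_inj_uniq ?iota_uniq // => i j /invr_inj /eqP.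
by rewrite eqr_nat => /eqP[].
Qed.

Definition idxs (b j : nat) : seq (R * nat) :=
  [seq (x, k) | x <- 1 :: gens b, k <- iota 0 (if x == 1 then j else 4%N)].

Lemma gens_neq1 b x : x \in gens b -> (x == 1) = false.
Proof. by move=> /gens_itv /andP[_ h]; rewrite lt_eqF. Qed.

Lemma size_idxs b j : size (idxs b j) = (j + 4 * b.+2)%N.
Proof.
rewrite size_allpairs_dep (eq_map (fun x => size_iota 0 _)) map_cons eqxx.
rewrite -cat1s sumn_cat [sumn [:: j]]/= addn0; congr addn.
have /eq_in_map -> :
    {in gens b, (fun x => if x == 1 then j else 4%N) =1 fun=> 4%N}.
  by move=> x /gens_neq1 ->.
by rewrite sumnE big_map big_const_seq count_predT iter_addn_0 size_cat size_map size_iota.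
Qed.

Lemma mem_idxs b j x k : (x, k) \in idxs b j =
  ((x == 1) && (k < j)%N) || ((x \in gens b) && (k < 4)%N).
Proof.
apply/allpairsPdep/idP => [[y [l [+ + [-> ->]]]]|].
  rewrite inE mem_iota => /orP[/eqP ->|yg]; first by rewrite eqxx => /= ->.
  by rewrite (gens_neq1 yg) yg.
case/orP=> [/andP[/eqP -> hk]|/andP[hx hk]].
  by exists 1, k; rewrite eqxx inE eqxx mem_iota.
by exists x, k; rewrite inE hx orbT (gens_neq1 hx) mem_iota.
Qed.

Lemma uniq_idxs b j : uniq (idxs b j).
Proof.
apply: allpairs_uniq_dep => [|x _|[x k] [y l] _ _ /= [-> ->]] //; last exact: iota_uniq.
by rewrite cons_uniq uniq_gens andbT; apply/negP => /gens_neq1; rewrite eqxx.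
Qed.

Lemma idxs_is_idx b j : (j <= 4)%N -> {in idxs b j, forall i, is_idx i}.
Proof.
move=> j4 [x k]; rewrite mem_idxs /is_idx /= => /orP[/andP[/eqP -> hk]|].
  by rewrite ltr01 lexx (leq_trans hk).
by move=> /andP[/gens_itv/andP[-> /ltW ->] ->].
Qed.

(** Circle neighbours of a point of the partial square lie in the two squares always present; those
    of any other point lie in its own full square. So [j] is free. *)
Lemma nbr_idxs b j m : (j <= 4)%N ->
  {in idxs b j, forall i, {subset nbr i <= map cpt (idxs b j) ++ map ax (heights m)}}.
Proof.
move=> j4; have mA t : t \in heights m -> ax t \in map cpt (idxs b j) ++ map ax (heights m).
  by move=> ht; rewrite mem_cat map_f ?orbT.
have mC x k : x \in gens b -> (k < 4)%N ->
    cpt (x, k) \in map cpt (idxs b j) ++ map ax (heights m).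
  by move=> hx hk; rewrite mem_cat map_f // mem_idxs hx hk orbT.
have h1 : 1 \in heights m.
  by rewrite -height1 height_in.
have hc : c \in heights m by rewrite !inE eqxx orbT.
have hNc : - c \in heights m by rewrite !inE eqxx !orbT.
have hN1 : - 1 \in heights m by rewrite !inE eqxx.
have gc : c \in gens b by rewrite !inE eqxx.
have gcc : cc c \in gens b by rewrite !inE eqxx orbT.
move=> [x k]; rewrite mem_idxs /nbr /= => /orP[/andP[-> hk]|/andP[hx hk]] v.
  by rewrite !inE => /or4P[] /eqP ->; auto; apply: mC => //;
    [exact: leq_trans hk j4|exact: ltn_mod].
by rewrite (gens_neq1 hx) !inE => /or4P[] /eqP ->; auto; apply: mC => //; exact: ltn_mod.
Qed.

Lemma size_links m : size (links m) = m.+4.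
Proof. by rewrite size_cat size_map size_iota. Qed.

Lemma size_heights m : size (heights m) = m.+2.+3.
Proof. by rewrite size_cat size_map size_iota. Qed.

(** * Assembly and optimisation *)

Lemma exists_suspension (p q : nat) : (8 <= p)%N -> (5 <= q)%N ->
  exists (S : {fset point}) (r : S -> R),
    [/\ suspension r, #|` S| = (p + q)%N & (p * q + 4 * p + (q - 1) <= e r)%N].
Proof.
(* Two full squares and five heights are always present; [b] and [m] count the additional ones, and
   [hp], [hq] keep the subtractions from truncating. *)
move=> hp hq; pose b := (p %/ 4 - 2)%N; pose j := (p %% 4)%N; pose m := (q - 5)%N.
have j4 : (j <= 4)%N by rewrite ltnW // ltn_mod.
have [S [r [sS cS eS]]] := suspension_of_lists (uniq_heights m) (uniq_links m)
  (@linksP m) (uniq_idxs b j) (@idxs_is_idx b j j4) (@nbr_idxs b j m j4).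
have Ip : size (idxs b j) = p by rewrite size_idxs /b /j; lia.
have Hq : size (heights m) = q by rewrite size_heights /m; lia.
have Tq : size (links m) = (q - 1)%N by rewrite size_links /m; lia.
by rewrite Ip Hq Tq in cS eS; exists S, r; split.
Qed.

End Construction.

Theorem theorem2 (R : realType) (n : nat) (hn : (13 <= n)%N) :
  exists (S : {fset 'rV[R]_3}) (r : S -> R),
    [/\ suspension r, #|` S| = n &
        Num.ceil (n%:R ^+ 2 / 4 + 5 * n%:R / 2 : R) + 1 <= (e r)%:Z].
Proof.
(* With q = n - p the count is p (n + 3 - p) + n - 1, largest at p near (n + 3) / 2; n >= 13 gives p
   >= 8 and q >= 5. *)
pose p := ((n + 3) %/ 2)%N; pose q := (n - p)%N.
have [||S [r [sS cS eS]]] := @exists_suspension R p q; rewrite ?/q ?/p; try lia.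
exists S, r; split => //; first by rewrite cS /q /p; lia.
(* As [e r] is an integer, the ceiling bound amounts to n^2/4 + 5n/2 <= [e r] - 1, here multiplied
   by 4. For even n the count attains it exactly. *)
have h : (n ^ 2 + 10 * n + 4 <= 4 * e r)%N.
  apply: leq_trans (leq_mul (leqnn 4) eS).
  have [d|d] : n = (2 * n./2)%N \/ n = (2 * n./2 + 1)%N by lia.
    have -> : q = (n./2 - 1)%N by rewrite /q /p; lia.
    have -> : p = (n./2 + 1)%N by rewrite /p; lia.
    nia.
  have -> : q = (n./2 - 1)%N by rewrite /q /p; lia.
  have -> : p = (n./2 + 2)%N by rewrite /p; lia.
  nia.
rewrite -lerBrDr ceil_le_int intrB.
have : (n ^ 2 + 10 * n + 4)%:R <= (4 * e r)%:R :> R by rewrite ler_nat.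
rewrite !natrD !natrM -pmulrn; lra.
Qed.
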